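(* The class of focus/directrix hyperbolas in $\mathbb{H}^2$ is not equal to the class of two-focus hyperbolas in $\mathbb{H}^2$. However, every two-focus hyperbola in $\mathbb{H}^2$ is a focus/directrix hyperbola.
   Context: $\mathbb{H}^2$ is the hyperbolic plane (constant curvature $-1$) with Riemannian distance $d$; lines are geodesics. Focus/directrix hyperbola: a set $\{x\in\mathbb{H}^2 : \sinh d(x,a_1)=\varepsilon\,\sinh d(x,\ell)\}$, where $a_1\in\mathbb{H}^2$ (the focus), $\ell$ is a line not passing through $a_1$ (the directrix), and $\varepsilon>1$ (the eccentricity). Two-focus hyperbola: a set $\{x\in\mathbb{H}^2 : |d(x,a_1)-d(x,a_2)|=c\}$, where $a_1,a_2\in\mathbb{H}^2$ are distinct points (the foci) and $c$ is a constant with $0<c<d(a_1,a_2)$. *)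

(* Defs.v *)
From Stdlib Require Import Reals.
From Coquelicot Require Import Coquelicot.
Open Scope R_scope.

(* Hyperboloid model: the upper sheet of <x,x> = -1 in Minkowski 3-space,
   with the Riemannian distance given by cosh (hdist x y) = - <x,y>. *)
Record H2 : Type := mkH2 {
  h0 : R;
  h1 : R;
  h2 : R;
  H2_norm : - h0 ^ 2 + h1 ^ 2 + h2 ^ 2 = -1;
  H2_sheet : 0 < h0 }.

Definition mink (x y : H2) : R := - (h0 x * h0 y) + h1 x * h1 y + h2 x * h2 y.

(* Used only on [1, +oo). *)
Definition arcosh (t : R) : R := ln (t + sqrt (t ^ 2 - 1)).

Definition hdist (x y : H2) : R := arcosh (- mink x y).

(* Complete geodesics. In H2 every geodesic minimizes globally, so these are
   the images of the distance-preserving maps of the whole real line. *)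
Definition is_line (l : H2 -> Prop) : Prop :=
  exists gamma : R -> H2,
    (forall s t : R, hdist (gamma s) (gamma t) = Rabs (s - t)) /\
    (forall x : H2, l x <-> exists t : R, gamma t = x).

(* The infimum is finite whenever l is nonempty, in particular for a line. *)
Definition hdist_set (x : H2) (l : H2 -> Prop) : R :=
  real (Glb_Rbar (fun r : R => exists y : H2, l y /\ r = hdist x y)).

Definition focus_directrix_hyperbola (S : H2 -> Prop) : Prop :=
  exists (a1 : H2) (l : H2 -> Prop) (eps : R),
    is_line l /\ ~ l a1 /\ 1 < eps /\
    (forall x : H2, S x <-> sinh (hdist x a1) = eps * sinh (hdist_set x l)).

Definition two_focus_hyperbola (S : H2 -> Prop) : Prop :=
  exists (a1 a2 : H2) (c : R),
    a1 <> a2 /\ 0 < c < hdist a1 a2 /\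
    (forall x : H2, S x <-> Rabs (hdist x a1 - hdist x a2) = c).

(* Main.v *)
Require Import Defs.
From Stdlib Require Import Reals.
From Coquelicot Require Import Coquelicot.
From Stdlib Require Import Lra Psatz.
Open Scope R_scope.

(* For a unit spacelike n, sinh d(x, l) = |<x,n>| where l is the line polar to n.
   With d_i = d(x, a_i) and d_1 + d_2 > c, the equation |d_1 - d_2| = c says
   cosh d_2 = cosh (d_1 + c) or cosh (d_1 - c), that is
   sinh c sinh d_1 = |cosh c cosh d_1 - cosh d_2| = |<x, cosh c a_1 - a_2>|,
   a focus/directrix equation with focus a_1.
   Conversely, a focus/directrix hyperbola of eccentricity at most exp d(a_1, l) has
   only one branch, on which some linear functional f is positive and bounded although
   the branch is unbounded. A two-focus hyperbola is invariant under the reflection r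
   through the midpoint m of its foci, and x + r x is a multiple of m that grows with x,
   so f(x) + f(r x) cannot stay positive and bounded. *)

(** * Hyperbolic functions and [arcosh] *)

Lemma cosh2_sinh2 (x : R) : cosh x ^ 2 = 1 + sinh x ^ 2.
Proof.
  assert (E : exp x * exp (- x) = 1) by (rewrite <- exp_plus, Rplus_opp_r; apply exp_0).
  unfold cosh, sinh. nra.
Qed.

Lemma cosh_add (x y : R) : cosh (x + y) = cosh x * cosh y + sinh x * sinh y.
Proof.
  unfold cosh, sinh. rewrite Ropp_plus_distr, !exp_plus. field.
Qed.

Lemma cosh_neg (x : R) : cosh (- x) = cosh x.
Proof. unfold cosh. rewrite Ropp_involutive. lra. Qed.

Lemma sinh_neg (x : R) : sinh (- x) = - sinh x.
Proof. unfold sinh. rewrite Ropp_involutive. lra. Qed.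

Lemma cosh_sub (x y : R) : cosh (x - y) = cosh x * cosh y - sinh x * sinh y.
Proof. unfold Rminus. rewrite cosh_add, cosh_neg, sinh_neg. lra. Qed.

Lemma cosh_abs (x : R) : cosh (Rabs x) = cosh x.
Proof. unfold Rabs. destruct (Rcase_abs x); [apply cosh_neg | reflexivity]. Qed.

Lemma cosh_pos (x : R) : 0 < cosh x.
Proof. unfold cosh. pose proof (exp_pos x). pose proof (exp_pos (- x)). lra. Qed.

Lemma sinh_pos (x : R) : 0 < x -> 0 < sinh x.
Proof. intros H. rewrite <- sinh_0. apply sinh_lt, H. Qed.

Lemma sinh_nonneg (x : R) : 0 <= x -> 0 <= sinh x.
Proof. intros [H | <-]; [left; apply sinh_pos, H | rewrite sinh_0; lra]. Qed.

Lemma cosh_lt (x y : R) : 0 <= x < y -> cosh x < cosh y.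
Proof.
  intros [Hx Hy].
  pose proof (cosh2_sinh2 x). pose proof (cosh2_sinh2 y).
  pose proof (cosh_pos x). pose proof (cosh_pos y).
  pose proof (sinh_nonneg x Hx). pose proof (sinh_lt x y Hy). nra.
Qed.

Lemma cosh_le_inv (x y : R) : 0 <= x -> 0 <= y -> cosh x <= cosh y -> x <= y.
Proof.
  intros Hx Hy H. destruct (Rle_lt_dec x y) as [|Hl]; [assumption|].
  pose proof (cosh_lt y x (conj Hy Hl)). lra.
Qed.

Lemma cosh_inj_nonneg (x y : R) : 0 <= x -> 0 <= y -> cosh x = cosh y -> x = y.
Proof. intros Hx Hy H. apply Rle_antisym; apply cosh_le_inv; lra. Qed.

Lemma exp_arcosh (t : R) : 1 <= t -> exp (arcosh t) = t + sqrt (t ^ 2 - 1).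
Proof.
  intros H. pose proof (sqrt_pos (t ^ 2 - 1)). unfold arcosh. apply exp_ln. lra.
Qed.

Lemma exp_opp_arcosh (t : R) : 1 <= t -> exp (- arcosh t) = t - sqrt (t ^ 2 - 1).
Proof.
  intros H. rewrite exp_Ropp, exp_arcosh by exact H.
  pose proof (sqrt_pos (t ^ 2 - 1)).
  assert (E : sqrt (t ^ 2 - 1) * sqrt (t ^ 2 - 1) = t ^ 2 - 1) by (apply sqrt_sqrt; nra).
  apply Rmult_eq_reg_l with (t + sqrt (t ^ 2 - 1)); [|lra].
  rewrite Rinv_r by lra. lra.
Qed.

Lemma cosh_arcosh (t : R) : 1 <= t -> cosh (arcosh t) = t.
Proof. intros H. unfold cosh. rewrite exp_arcosh, exp_opp_arcosh by exact H. lra. Qed.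

Lemma sinh_arcosh (t : R) : 1 <= t -> sinh (arcosh t) = sqrt (t ^ 2 - 1).
Proof. intros H. unfold sinh. rewrite exp_arcosh, exp_opp_arcosh by exact H. lra. Qed.

Lemma arcosh_nonneg (t : R) : 1 <= t -> 0 <= arcosh t.
Proof.
  intros H. destruct (Rle_lt_dec 0 (arcosh t)) as [|Hn]; [assumption|].
  pose proof (sinh_arcosh t H). pose proof (sqrt_pos (t ^ 2 - 1)).
  pose proof (sinh_lt _ _ Hn). rewrite sinh_0 in *. lra.
Qed.

Lemma arcosh_le (s t : R) : 1 <= s <= t -> arcosh s <= arcosh t.
Proof.
  intros [Hs Ht]. apply cosh_le_inv; try (apply arcosh_nonneg; lra).
  rewrite !cosh_arcosh; lra.
Qed.

Lemma arcosh_cosh (r : R) : arcosh (cosh r) = Rabs r.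
Proof.
  assert (H : 1 <= cosh r)
    by (pose proof (cosh2_sinh2 r); pose proof (cosh_pos r); nra).
  apply cosh_inj_nonneg; [apply arcosh_nonneg, H | apply Rabs_pos |].
  rewrite cosh_arcosh, cosh_abs by exact H. reflexivity.
Qed.

(** * Bounds on the Minkowski product and the triangle inequality *)

(* Cauchy-Schwarz weighted by [h0 a / h0 x], which keeps the growth in [h0 x]. *)
Lemma mink_bound (x a : H2) : (h0 a / h0 x + h0 x / h0 a) / 2 <= - mink x a.
Proof.
  destruct x as [x0 x1 x2 Hx px], a as [a0 a1 a2 Ha pa]. unfold mink; simpl in *.
  apply Rmult_le_reg_l with (2 * (x0 * a0)); [nra|].
  replace (2 * (x0 * a0) * ((a0 / x0 + x0 / a0) / 2)) with (a0 ^ 2 + x0 ^ 2) by (field; lra).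
  pose proof (pow2_ge_0 (a0 * x1 - x0 * a1)). pose proof (pow2_ge_0 (a0 * x2 - x0 * a2)).
  assert (a0 ^ 2 * (x0 ^ 2 - x1 ^ 2 - x2 ^ 2 - 1) = 0) by nra.
  assert (x0 ^ 2 * (a0 ^ 2 - a1 ^ 2 - a2 ^ 2 - 1) = 0) by nra.
  nra.
Qed.

Lemma mink_growth (x a : H2) : h0 x / (2 * h0 a) <= - mink x a.
Proof.
  eapply Rle_trans; [|apply mink_bound].
  pose proof (H2_sheet x). pose proof (H2_sheet a).
  assert (0 < h0 a / h0 x) by (apply Rdiv_lt_0_compat; assumption).
  replace (h0 x / (2 * h0 a)) with (h0 x / h0 a / 2) by (field; lra). lra.
Qed.

Lemma mink_ge_1 (x a : H2) : 1 <= - mink x a.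
Proof.
  eapply Rle_trans; [|apply mink_bound].
  pose proof (H2_sheet x). pose proof (H2_sheet a).
  apply Rmult_le_reg_l with (2 * (h0 x * h0 a)); [nra|].
  replace (2 * (h0 x * h0 a) * ((h0 a / h0 x + h0 x / h0 a) / 2))
    with (h0 a ^ 2 + h0 x ^ 2) by (field; lra).
  pose proof (pow2_ge_0 (h0 a - h0 x)). nra.
Qed.

(** Otherwise [-v] would lie on the upper sheet, and [mink_ge_1] would make its product with [a] at
    most -1. This places constructed points on the upper sheet. *)
Lemma sheet_criterion (a : H2) (v0 v1 v2 : R) :
  - v0 ^ 2 + v1 ^ 2 + v2 ^ 2 = -1 ->
  - (v0 * h0 a) + v1 * h1 a + v2 * h2 a < 0 -> 0 < v0.
Proof.
  intros Hv Ha. destruct (Rlt_le_dec 0 v0) as [|Hn]; [assumption|].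
  assert (Hp : 0 < - v0) by nra.
  assert (Hv' : - (- v0) ^ 2 + (- v1) ^ 2 + (- v2) ^ 2 = -1) by nra.
  pose proof (mink_ge_1 (mkH2 (- v0) (- v1) (- v2) Hv' Hp) a) as H.
  unfold mink in H; simpl in H. lra.
Qed.

Lemma hdist_nonneg (x y : H2) : 0 <= hdist x y.
Proof. apply arcosh_nonneg, mink_ge_1. Qed.

Lemma cosh_hdist (x y : H2) : cosh (hdist x y) = - mink x y.
Proof. apply cosh_arcosh, mink_ge_1. Qed.

Lemma sinh_hdist (x y : H2) : sinh (hdist x y) = sqrt ((- mink x y) ^ 2 - 1).
Proof. apply sinh_arcosh, mink_ge_1. Qed.

(* The Gram determinant of three vectors in Minkowski space is minus the square
   of their determinant. *)
Lemma hdist_triangle (x a b : H2) : hdist a b <= hdist x a + hdist x b.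
Proof.
  pose proof (hdist_nonneg x a). pose proof (hdist_nonneg x b).
  apply cosh_le_inv; [apply hdist_nonneg | lra |].
  rewrite cosh_add.
  pose proof (sinh_nonneg _ H) as Ha. pose proof (sinh_nonneg _ H0) as Hb.
  pose proof (cosh2_sinh2 (hdist x a)) as Ea. pose proof (cosh2_sinh2 (hdist x b)) as Eb.
  rewrite !cosh_hdist in *.
  set (p := sinh (hdist x a)) in *. set (q := sinh (hdist x b)) in *.
  (* The hyperbolic law of cosines at [x], with the cosine of the angle bounded by 1 in absolute
     value. *)
  assert (G : (- mink a b - mink x a * mink x b) ^ 2 <= (p * q) ^ 2).
  { rewrite Rpow_mult_distr.
    replace (p ^ 2) with ((- mink x a) ^ 2 - 1) by lra.
    replace (q ^ 2) with ((- mink x b) ^ 2 - 1) by lra.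
    clear. destruct x as [x0 x1 x2 Hx px], a as [a0 a1 a2 Ha pa], b as [b0 b1 b2 Hb pb].
    unfold mink; simpl h0 in *; simpl h1 in *; simpl h2 in *.
    pose proof (pow2_ge_0 (x0 * (a1 * b2 - a2 * b1) - x1 * (a0 * b2 - a2 * b0)
                           + x2 * (a0 * b1 - a1 * b0))) as D.
    set (X := - x0 ^ 2 + x1 ^ 2 + x2 ^ 2) in *.
    set (A := - a0 ^ 2 + a1 ^ 2 + a2 ^ 2) in *.
    set (B := - b0 ^ 2 + b1 ^ 2 + b2 ^ 2) in *.
    set (xa := - (x0 * a0) + x1 * a1 + x2 * a2).
    set (xb := - (x0 * b0) + x1 * b1 + x2 * b2).
    set (ab := - (a0 * b0) + a1 * b1 + a2 * b2).
    assert (E : (x0 * (a1 * b2 - a2 * b1) - x1 * (a0 * b2 - a2 * b0)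
                           + x2 * (a0 * b1 - a1 * b0)) ^ 2
      = - (X * A * B + 2 * xa * xb * ab - X * ab ^ 2 - A * xb ^ 2 - B * xa ^ 2))
      by (unfold X, A, B, xa, xb, ab; ring).
    rewrite E, Hx, Ha, Hb in D. nra. }
  assert (0 <= p * q) by (apply Rmult_le_pos; assumption).
  nra.
Qed.

(** * Lines as polars of unit spacelike vectors, and distances to them *)

(** The Minkowski product with an ambient vector [n], which may be spacelike, unlike the arguments
    of [mink]. *)
Definition pairing (n0 n1 n2 : R) (x : H2) : R :=
  - (n0 * h0 x) + n1 * h1 x + n2 * h2 x.

Definition polar_line (n0 n1 n2 : R) (x : H2) : Prop := pairing n0 n1 n2 x = 0.

Lemma H2_eq (x y : H2) : h0 x = h0 y -> h1 x = h1 y -> h2 x = h2 y -> x = y.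
Proof.
  destruct x, y; simpl; intros; subst. f_equal; apply Classical_Prop.proof_irrelevance.
Qed.

(** The plane orthogonal to [n] has the orthonormal basis [e = (q, n0 n1 / q, n0 n2 / q)], timelike,
    and [f = (0, - n2 / q, n1 / q)], spacelike; the line is [cosh t e + sinh t f]. *)
Lemma polar_line_is_line (n0 n1 n2 : R) :
  - n0 ^ 2 + n1 ^ 2 + n2 ^ 2 = 1 -> is_line (polar_line n0 n1 n2).
Proof.
  intros Hn.
  set (q := sqrt (1 + n0 ^ 2)).
  assert (Hq : 0 < q) by (apply sqrt_lt_R0; nra).
  assert (Eq : q ^ 2 = 1 + n0 ^ 2) by (unfold q; apply pow2_sqrt; nra).
  assert (En : n1 ^ 2 + n2 ^ 2 = q ^ 2) by lra.
  set (y0 := fun t => q * cosh t).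
  set (y1 := fun t => (n0 * n1 * cosh t - n2 * sinh t) / q).
  set (y2 := fun t => (n0 * n2 * cosh t + n1 * sinh t) / q).
  assert (P : forall s t, - (y0 s * y0 t) + y1 s * y1 t + y2 s * y2 t
                          = - (cosh s * cosh t - sinh s * sinh t)).
  { intros s t. unfold y0, y1, y2.
    transitivity (- (q ^ 2) * (cosh s * cosh t)
      + (n1 ^ 2 + n2 ^ 2) / q ^ 2 * (n0 ^ 2 * (cosh s * cosh t) + sinh s * sinh t));
      [field; lra|].
    rewrite En. replace (n0 ^ 2) with (q ^ 2 - 1) by lra. field. lra. }
  assert (Y : forall t, - y0 t ^ 2 + y1 t ^ 2 + y2 t ^ 2 = -1).
  { intros t. pose proof (P t t). pose proof (cosh2_sinh2 t). lra. }
  assert (Z : forall t, 0 < y0 t).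
  { intros t. apply Rmult_lt_0_compat; [exact Hq | apply cosh_pos]. }
  exists (fun t => mkH2 (y0 t) (y1 t) (y2 t) (Y t) (Z t)). split.
  - intros s t. unfold hdist, mink; simpl. rewrite P, Ropp_involutive, <- cosh_sub.
    apply arcosh_cosh.
  - intros x. unfold polar_line, pairing. split.
    (* The parameter is read off from the product of [x] with [f], which equals [sinh t]. *)
    + intros Hx. exists (arcsinh ((n1 * h2 x - n2 * h1 x) / q)).
      set (t := arcsinh _).
      assert (Es : sinh t = (n1 * h2 x - n2 * h1 x) / q) by apply sinh_arcsinh.
      assert (Hs : n1 * h2 x - n2 * h1 x = q * sinh t) by (rewrite Es; field; lra).
      assert (E0 : h0 x = q * cosh t).
      { pose proof (H2_norm x) as N. pose proof (H2_sheet x). pose proof (cosh_pos t).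
        (* Lagrange's identity for [(n1, n2)] and [(h1 x, h2 x)]. *)
        assert (K : q ^ 2 * (h1 x ^ 2 + h2 x ^ 2) = (n0 * h0 x) ^ 2 + (q * sinh t) ^ 2)
          by (rewrite <- Hs, <- En; replace (n0 * h0 x) with (n1 * h1 x + n2 * h2 x) by lra; ring).
        assert (h0 x ^ 2 = (q * cosh t) ^ 2).
        { rewrite Rpow_mult_distr, cosh2_sinh2.
          replace (h1 x ^ 2 + h2 x ^ 2) with (h0 x ^ 2 - 1) in K by lra.
          rewrite Rpow_mult_distr in K.
          replace (n0 ^ 2) with (q ^ 2 - 1) in K by lra. lra. }
        assert (0 < q * cosh t) by (apply Rmult_lt_0_compat; assumption). nra. }
      assert (E1 : n1 * h1 x + n2 * h2 x = n0 * (q * cosh t)) by (rewrite <- E0; lra).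
      apply H2_eq; simpl; [symmetry; exact E0 | |].
      * unfold y1. apply Rmult_eq_reg_l with (q ^ 2); [|nra].
        transitivity (n1 * (n0 * (q * cosh t)) - n2 * (q * sinh t)); [field; lra|].
        rewrite <- E1, <- Hs, <- En. ring.
      * unfold y2. apply Rmult_eq_reg_l with (q ^ 2); [|nra].
        transitivity (n2 * (n0 * (q * cosh t)) + n1 * (q * sinh t)); [field; lra|].
        rewrite <- E1, <- Hs, <- En. ring.
    + intros [t <-]. simpl. unfold y0, y1, y2.
      transitivity (n0 * cosh t * ((n1 ^ 2 + n2 ^ 2) - q ^ 2) / q); [field; lra|].
      rewrite En. field. lra.
Qed.

(* The foot of the perpendicular from [x] is [x - <x,n> n], normalized. *)
Lemma sinh_hdist_polar_line (n0 n1 n2 : R) (x : H2) :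
  - n0 ^ 2 + n1 ^ 2 + n2 ^ 2 = 1 ->
  sinh (hdist_set x (polar_line n0 n1 n2)) = Rabs (pairing n0 n1 n2 x).
Proof.
  intros Hn. set (nu := pairing n0 n1 n2 x).
  (* The vector [x - nu n] has Minkowski square [- (1 + nu ^ 2)], so [q] normalizes it; [q] is also
     the cosh of the distance from [x] to the foot. *)
  set (q := sqrt (1 + nu ^ 2)).
  assert (Hq : 0 < q) by (apply sqrt_lt_R0; nra).
  assert (Eq : q ^ 2 = 1 + nu ^ 2) by (unfold q; apply pow2_sqrt; nra).
  assert (Hq1 : 1 <= q) by nra.
  pose proof (H2_norm x) as Nx.
  assert (Enu : nu = - (n0 * h0 x) + n1 * h1 x + n2 * h2 x) by reflexivity.
  set (f0 := (h0 x - nu * n0) / q).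
  set (f1 := (h1 x - nu * n1) / q).
  set (f2 := (h2 x - nu * n2) / q).
  assert (Hf : - f0 ^ 2 + f1 ^ 2 + f2 ^ 2 = -1).
  { unfold f0, f1, f2.
    transitivity (((- h0 x ^ 2 + h1 x ^ 2 + h2 x ^ 2)
      - 2 * nu * (- (n0 * h0 x) + n1 * h1 x + n2 * h2 x)
      + nu ^ 2 * (- n0 ^ 2 + n1 ^ 2 + n2 ^ 2)) / q ^ 2); [field; lra|].
    rewrite <- Enu, Nx, Hn.
    replace (-1 - 2 * nu * nu + nu ^ 2 * 1) with (- q ^ 2) by lra. field. lra. }
  assert (Hfx : - (f0 * h0 x) + f1 * h1 x + f2 * h2 x = - q).
  { unfold f0, f1, f2.
    transitivity (((- h0 x ^ 2 + h1 x ^ 2 + h2 x ^ 2)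
      - nu * (- (n0 * h0 x) + n1 * h1 x + n2 * h2 x)) / q); [field; lra|].
    rewrite <- Enu, Nx.
    replace (-1 - nu * nu) with (- q ^ 2) by lra. field. lra. }
  assert (Pf : 0 < f0) by (apply (sheet_criterion x f0 f1 f2 Hf); lra).
  set (f := mkH2 f0 f1 f2 Hf Pf).
  assert (Lf : polar_line n0 n1 n2 f).
  { unfold polar_line, pairing, f; simpl. unfold f0, f1, f2.
    transitivity (((- (n0 * h0 x) + n1 * h1 x + n2 * h2 x)
      - nu * (- n0 ^ 2 + n1 ^ 2 + n2 ^ 2)) / q); [field; lra|].
    rewrite <- Enu, Hn. field. lra. }
  assert (Df : hdist x f = arcosh q).
  { unfold hdist, mink, f; simpl. f_equal. lra. }
  assert (D : hdist_set x (polar_line n0 n1 n2) = arcosh q).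
  { unfold hdist_set.
    rewrite (is_glb_Rbar_unique _ (Finite (arcosh q))); [reflexivity|]. split.
    - intros r [y [Ly ->]]. simpl. unfold hdist. apply arcosh_le. split; [exact Hq1|].
      pose proof (mink_ge_1 f y) as B. unfold mink, f in B; simpl in B.
      unfold polar_line, pairing in Ly. unfold mink.
      (* Since [q f = x - nu n] and [y] is orthogonal to [n], scaling the bound for [f] and [y] by
         [q] bounds the product of [x] and [y]. *)
      apply Rmult_le_compat_l with (r := q) in B; [|lra].
      replace (q * - (- (f0 * h0 y) + f1 * h1 y + f2 * h2 y))
        with (- (- (h0 x * h0 y) + h1 x * h1 y + h2 x * h2 y)
              + nu * (- (n0 * h0 y) + n1 * h1 y + n2 * h2 y)) in B
        by (unfold f0, f1, f2; field; lra).
      rewrite Ly in B. lra.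
    - intros b Hb. apply Hb. exists f. split; [exact Lf | symmetry; exact Df]. }
  rewrite D, sinh_arcosh by exact Hq1. rewrite Eq, <- sqrt_Rsqr_abs. f_equal. unfold Rsqr. ring.
Qed.

(** * From two foci to a focus and a directrix *)

(** The two signs of the right-hand absolute value give [cosh d2 = cosh (d1 + c)] and
    [cosh d2 = cosh (d1 - c)]. As cosh is even, the latter also allows [d2 = c - d1], which
    [c < d1 + d2] excludes. *)
Lemma Rabs_cosh_cosh_sub_iff (c d1 d2 : R) :
  0 < c -> 0 <= d1 -> 0 <= d2 -> c < d1 + d2 ->
  (Rabs (d1 - d2) = c <-> sinh c * sinh d1 = Rabs (cosh c * cosh d1 - cosh d2)).
Proof.
  intros Hc H1 H2 H12.
  pose proof (sinh_pos c Hc) as Sc. pose proof (sinh_nonneg d1 H1) as S1.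
  assert (P : 0 <= sinh c * sinh d1) by nra.
  split.
  - intros E. assert (K : d2 = d1 + c \/ d2 = d1 - c).
    { unfold Rabs in E. destruct (Rcase_abs (d1 - d2)); lra. }
    destruct K as [-> | ->]; [rewrite cosh_add | rewrite cosh_sub].
    + rewrite <- Rabs_Ropp, Rabs_pos_eq; lra.
    + rewrite Rabs_pos_eq; lra.
  - intros E. assert (K : cosh d2 = cosh (d1 + c) \/ cosh d2 = cosh (Rabs (d1 - c))).
    { rewrite cosh_abs, cosh_add, cosh_sub. unfold Rabs in E.
      destruct (Rcase_abs _) in E; lra. }
    destruct K as [K | K]; apply cosh_inj_nonneg in K; try lra; try apply Rabs_pos.
    + subst d2. rewrite <- Rabs_Ropp, Rabs_pos_eq; lra.
    + unfold Rabs in *. destruct (Rcase_abs (d1 - c)), (Rcase_abs (d1 - d2)); lra.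
Qed.

Lemma two_focus_is_focus_directrix (S : H2 -> Prop) :
  two_focus_hyperbola S -> focus_directrix_hyperbola S.
Proof.
  intros (a1 & a2 & c & _ & [Hc Hca] & HS).
  (* The vector [cosh c a1 - a2]; divided by its norm [q], it is the normal of the directrix. *)
  set (w0 := cosh c * h0 a1 - h0 a2).
  set (w1 := cosh c * h1 a1 - h1 a2).
  set (w2 := cosh c * h2 a1 - h2 a2).
  assert (HD : cosh c < - mink a1 a2).
  { rewrite <- cosh_hdist. apply cosh_lt. lra. }
  pose proof (cosh_pos c) as Cc. pose proof (sinh_pos c Hc) as Sc.
  pose proof (cosh2_sinh2 c) as Ec.
  set (W := - w0 ^ 2 + w1 ^ 2 + w2 ^ 2).
  assert (EW : W = - cosh c ^ 2 - 1 + 2 * cosh c * - mink a1 a2).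
  { pose proof (H2_norm a1) as N1. pose proof (H2_norm a2) as N2.
    transitivity (cosh c ^ 2 * (- h0 a1 ^ 2 + h1 a1 ^ 2 + h2 a1 ^ 2)
      + (- h0 a2 ^ 2 + h1 a2 ^ 2 + h2 a2 ^ 2) + 2 * cosh c * - mink a1 a2);
      [unfold W, w0, w1, w2, mink; ring|].
    rewrite N1, N2. ring. }
  (* This makes the eccentricity [q / sinh c] exceed 1; it comes from [cosh c < cosh d(a1, a2)]. *)
  assert (HW : sinh c ^ 2 < W) by nra.
  set (q := sqrt W).
  assert (Hq : 0 < q) by (apply sqrt_lt_R0; nra).
  assert (Eq : q ^ 2 = W) by (unfold q; apply pow2_sqrt; nra).
  assert (Hqs : sinh c < q) by nra.
  assert (Hn : - (w0 / q) ^ 2 + (w1 / q) ^ 2 + (w2 / q) ^ 2 = 1).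
  { transitivity (W / q ^ 2); [unfold W; field; lra | rewrite Eq; field; nra]. }
  assert (Hp : forall x, pairing (w0 / q) (w1 / q) (w2 / q) x
                         = - (cosh c * - mink x a1 - - mink x a2) / q).
  { intros x. unfold pairing, mink, w0, w1, w2. field. lra. }
  exists a1, (polar_line (w0 / q) (w1 / q) (w2 / q)), (q / sinh c).
  split; [apply polar_line_is_line, Hn|].
  split.
  (* At [a1] the pairing is [(cosh d(a1, a2) - cosh c) / q], which is nonzero. *)
  { unfold polar_line. rewrite Hp. intros E.
    assert (mink a1 a1 = -1) as M by (pose proof (H2_norm a1); unfold mink; lra).
    rewrite M in E. apply (f_equal (Rmult q)) in E. field_simplify in E; lra. }
  split.
  { apply Rmult_lt_reg_r with (sinh c); [exact Sc|].
    unfold Rdiv. rewrite Rmult_assoc, Rinv_l by lra. lra. }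
  intros x. rewrite HS, sinh_hdist_polar_line by exact Hn. rewrite Hp.
  rewrite Rabs_cosh_cosh_sub_iff; try apply hdist_nonneg; try exact Hc.
  2: { pose proof (hdist_triangle x a1 a2). lra. }
  rewrite !cosh_hdist.
  unfold Rdiv at 2. rewrite Rabs_mult, Rabs_Ropp, Rabs_inv, (Rabs_pos_eq q) by lra.
  set (r := Rabs _).
  replace (q / sinh c * (r * / q)) with (r / sinh c) by (field; lra).
  split; intros E.
  - rewrite <- E. field. lra.
  - rewrite E. field. lra.
Qed.

(** * The symmetry of a two-focus hyperbola *)

(** Here [a] and [b] are the foci and [y = k (a + b) - x] is the reflection of [x] through their
    midpoint. The value of [k] makes it exchange the distances to the foci, so their difference only
    changes sign. *)
Lemma two_focus_reflection (S : H2 -> Prop) :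
  two_focus_hyperbola S ->
  exists (a b : H2), forall x, S x -> exists y k, S y /\
    k * (1 - mink a b) = - mink x a - mink x b /\
    h0 y + h0 x = k * (h0 a + h0 b) /\
    h1 y + h1 x = k * (h1 a + h1 b) /\
    h2 y + h2 x = k * (h2 a + h2 b).
Proof.
  intros (a & b & c & _ & _ & HS). exists a, b. intros x Hx.
  pose proof (mink_ge_1 a b) as D. pose proof (mink_ge_1 x b) as Xb.
  pose proof (H2_norm a) as Na. pose proof (H2_norm b) as Nb. pose proof (H2_norm x) as Nx.
  set (k := (- mink x a - mink x b) / (1 - mink a b)).
  assert (Ek : k * (1 - mink a b) = - mink x a - mink x b) by (unfold k; field; lra).
  set (y0 := k * (h0 a + h0 b) - h0 x).
  set (y1 := k * (h1 a + h1 b) - h1 x).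
  set (y2 := k * (h2 a + h2 b) - h2 x).
  assert (Ya : - (y0 * h0 a) + y1 * h1 a + y2 * h2 a = mink x b).
  { transitivity (k * ((- h0 a ^ 2 + h1 a ^ 2 + h2 a ^ 2) + mink a b) - mink x a);
      [unfold y0, y1, y2, mink; ring|]. rewrite Na. lra. }
  assert (Yb : - (y0 * h0 b) + y1 * h1 b + y2 * h2 b = mink x a).
  { transitivity (k * ((- h0 b ^ 2 + h1 b ^ 2 + h2 b ^ 2) + mink a b) - mink x b);
      [unfold y0, y1, y2, mink; ring|]. rewrite Nb. lra. }
  (* Both [x] and [y] have the same product with [a + b], so the terms in [k] cancel. *)
  assert (Hy : - y0 ^ 2 + y1 ^ 2 + y2 ^ 2 = -1).
  { transitivity (k * ((- (y0 * h0 a) + y1 * h1 a + y2 * h2 a)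
                       + (- (y0 * h0 b) + y1 * h1 b + y2 * h2 b))
      - k * (mink x a + mink x b) + (- h0 x ^ 2 + h1 x ^ 2 + h2 x ^ 2));
      [unfold y0, y1, y2, mink; ring|]. rewrite Ya, Yb, Nx. ring. }
  assert (Py : 0 < y0) by (apply (sheet_criterion a y0 y1 y2 Hy); lra).
  exists (mkH2 y0 y1 y2 Hy Py), k. split.
  - rewrite HS in *. unfold hdist in *.
    replace (mink (mkH2 y0 y1 y2 Hy Py) a) with (mink x b) by (symmetry; exact Ya).
    replace (mink (mkH2 y0 y1 y2 Hy Py) b) with (mink x a) by (symmetry; exact Yb).
    rewrite <- Rabs_Ropp, Ropp_minus_distr. exact Hx.
  - simpl. unfold y0, y1, y2. repeat split; [exact Ek | ring | ring | ring].
Qed.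

(** * A one-branch focus/directrix hyperbola that is not two-focus *)

Lemma H2_origin_norm : - 1 ^ 2 + 0 ^ 2 + 0 ^ 2 = -1.
Proof. ring. Qed.

Definition H2_origin : H2 := mkH2 1 0 0 H2_origin_norm Rlt_0_1.

(** The unit normal [(3/4, 5/4, 0)] gives [sinh d(a1, l) = 3/4], that is [d(a1, l) = ln 2]. The
    eccentricity 2 is then exactly [exp d(a1, l)], the borderline value for a single branch. *)
Definition one_branch (x : H2) : Prop :=
  sinh (hdist x H2_origin) = 2 * sinh (hdist_set x (polar_line (3 / 4) (5 / 4) 0)).

Lemma one_branch_focus_directrix : focus_directrix_hyperbola one_branch.
Proof.
  exists H2_origin, (polar_line (3 / 4) (5 / 4) 0), 2. repeat split; try tauto; try lra.
  - apply polar_line_is_line. field.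
  - unfold polar_line, pairing; simpl. lra.
Qed.

Lemma one_branch_iff (x : H2) :
  one_branch x <-> 2 * sqrt (h0 x ^ 2 - 1) = Rabs (5 * h1 x - 3 * h0 x).
Proof.
  unfold one_branch. rewrite sinh_hdist, sinh_hdist_polar_line by field.
  replace ((- mink x H2_origin) ^ 2) with (h0 x ^ 2) by (unfold mink; simpl; ring).
  replace (pairing (3 / 4) (5 / 4) 0 x) with (/ 4 * (5 * h1 x - 3 * h0 x))
    by (unfold pairing; field).
  rewrite Rabs_mult, (Rabs_pos_eq (/ 4)) by lra. lra.
Qed.

(* On the branch [5 x1 - x0 = 2 (x0 - sinh d) = 2 exp (- d)], [d] being the
   distance to the focus; the other branch lies outside the plane because the
   eccentricity is at most [exp d(a1, l) = 2]. *)
Lemma one_branch_strip (x : H2) : one_branch x -> 0 < 5 * h1 x - h0 x <= 2.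
Proof.
  rewrite one_branch_iff. intros E.
  pose proof (H2_norm x) as N. pose proof (H2_sheet x) as P.
  set (s := sqrt (h0 x ^ 2 - 1)) in *.
  assert (Hs : 0 <= s) by apply sqrt_pos.
  assert (Es : s ^ 2 = h0 x ^ 2 - 1) by (apply pow2_sqrt; nra).
  assert (H1 : h1 x <= s) by nra.
  assert (H2 : s < h0 x) by nra.
  assert (H3 : h0 x <= 1 + s) by nra.
  (* If [5 * h1 x - 3 * h0 x] is nonnegative, [H1] forces [h0 x <= s], against [H2]: the second
     branch is empty. *)
  unfold Rabs in E. destruct (Rcase_abs _) in E; lra.
Qed.

(** The point at distance [ln z] from the focus: [h0 x] and [s] are the cosh and sinh of [ln z],
    [x1] solves [5 x1 - h0 x = 2 / z], and the norm condition fixes the last coordinate up to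
    sign. *)
Lemma one_branch_unbounded (z : R) : 2 <= z -> exists x, one_branch x /\ z / 2 <= h0 x.
Proof.
  intros Hz.
  set (u := / z).
  assert (Ezu : z * u = 1) by (unfold u; field; lra).
  assert (Hu : 0 < u <= / 2).
  { split; [apply Rinv_0_lt_compat; lra | apply Rinv_le_contravar; lra]. }
  set (x1 := (z + 5 * u) / 10).
  set (s := (z - u) / 2).
  assert (Hr : 0 <= s ^ 2 - x1 ^ 2).
  { replace (s ^ 2 - x1 ^ 2) with ((s - x1) * (s + x1)) by ring.
    unfold s, x1. apply Rmult_le_pos; lra. }
  assert (Hx : - ((z + u) / 2) ^ 2 + x1 ^ 2 + sqrt (s ^ 2 - x1 ^ 2) ^ 2 = -1).
  { rewrite pow2_sqrt by exact Hr. unfold s. nra. }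
  assert (Px : 0 < (z + u) / 2) by lra.
  exists (mkH2 _ _ _ Hx Px). rewrite one_branch_iff. simpl h0. simpl h1. split; [|lra].
  replace (((z + u) / 2) ^ 2 - 1) with (s ^ 2) by (unfold s; nra).
  rewrite sqrt_pow2 by (unfold s; lra).
  rewrite <- Rabs_Ropp, Rabs_pos_eq; unfold s, x1; lra.
Qed.

Lemma one_branch_not_two_focus : ~ two_focus_hyperbola one_branch.
Proof.
  intros H. destruct (two_focus_reflection _ H) as (a & b & R).
  pose proof (H2_sheet a) as Pa. pose proof (H2_sheet b) as Pb.
  pose proof (mink_ge_1 a b) as D.
  set (m := 5 * (h1 a + h1 b) - (h0 a + h0 b)).
  (* For [f(x) = 5 * h1 x - h0 x], the sum [f(x) + f(y) = k m] lies in [(0, 4]] and [k] is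
     positive. *)
  assert (B : forall x, one_branch x ->
    0 < m /\ (- mink x a - mink x b) * m <= 4 * (1 - mink a b)).
  { intros x Hx. destruct (R x Hx) as (y & k & Hy & Ek & E0 & E1 & _).
    pose proof (one_branch_strip x Hx). pose proof (one_branch_strip y Hy).
    assert (Em : k * m = (5 * h1 x - h0 x) + (5 * h1 y - h0 y)) by (unfold m; nra).
    pose proof (mink_ge_1 x a). pose proof (mink_ge_1 x b).
    assert (Hk : 0 < k) by nra.
    split; [nra|]. rewrite <- Ek. nra. }
  assert (Hm : 0 < m).
  { destruct (one_branch_unbounded 2 (Rle_refl 2)) as (x & Hx & _). apply (B x Hx). }
  set (K := 4 * (1 - mink a b) / m).
  assert (HK : 0 < K) by (apply Rdiv_lt_0_compat; lra).
  (* Chosen so that [h0 x > 2 * h0 a * K]: then [- mink x a] alone exceeds [K], the bound that [B]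
     puts on [- mink x a - mink x b]. *)
  destruct (one_branch_unbounded (2 + 4 * h0 a * K)) as (x & Hx & Gx); [nra|].
  destruct (B x Hx) as [_ L].
  pose proof (mink_growth x a) as G. pose proof (mink_ge_1 x b).
  assert (G' : K < h0 x / (2 * h0 a)).
  { apply Rmult_lt_reg_r with (2 * h0 a); [lra|].
    replace (h0 x / (2 * h0 a) * (2 * h0 a)) with (h0 x) by (field; lra). lra. }
  assert (EK : 4 * (1 - mink a b) = K * m) by (unfold K; field; lra).
  rewrite EK in L. apply Rmult_le_reg_r in L; lra.
Qed.

Theorem theorem15 :
  ~ (forall S : H2 -> Prop,
       focus_directrix_hyperbola S <-> two_focus_hyperbola S) /\
  (forall S : H2 -> Prop,
     two_focus_hyperbola S -> focus_directrix_hyperbola S).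
Proof.
  split.
  - intros H. apply one_branch_not_two_focus, H, one_branch_focus_directrix.
  - exact two_focus_is_focus_directrix.
Qed.
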